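(* Let $\beta\in\mathbb{N}=\{0,1,2,\dots\}$ and $\alpha\in\mathbb{D}\setminus\{0\}$. Let $\phi_\alpha(z)=\dfrac{\alpha-z}{1-\overline{\alpha}z}$, let $\lambda\in\mathbb{T}$, and let $\phi=\phi_\alpha\circ(\lambda\phi_\alpha)$ be an elliptic automorphism of $\mathbb{D}$ (not a rotation) of finite order $N$, i.e. $N$ is the smallest positive integer with $\lambda^N=1$. If $N\ge 2(3+\beta)$, then the composition operator $C_\phi f=f\circ\phi$ is not complex symmetric on $A^2_\beta$.
   Context: $\mathbb{D}$ is the open unit disc and $\mathbb{T}$ the unit circle. For $\beta>-1$, $A^2_\beta$ is the Hilbert space of analytic functions $f(z)=\sum_{n\ge0}\widehat f(n)z^n$ on $\mathbb{D}$ with inner product $\langle f,g\rangle=\sum_{n\ge0}\frac{n!\,\Gamma(2+\beta)}{\Gamma(n+2+\beta)}\widehat f(n)\overline{\widehat g(n)}$ (equivalently the $L^2$ inner product with respect to $(\beta+1)(1-|z|^2)^\beta dA(z)$). A conjugation is a conjugate-linear map $C$ with $C^2=I$ and $\langle Cf,Cg\rangle=\langle g,f\rangle$; a bounded operator $T$ is complex symmetric if $CT=T^*C$ for some conjugation $C$. A rotation is a map $z\mapsto\mu z$ with $\mu\in\mathbb{T}$. *)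

(* Defs.v *)
From Stdlib Require Import Reals Arith Factorial.
From Coquelicot Require Import Coquelicot.
Open Scope C_scope.

Definition in_disc (z : C) : Prop := (Cmod z < 1)%R.

(* Weight of the A^2_beta norm for integer beta:
   n! Gamma(2+beta) / Gamma(n+2+beta) = n! (beta+1)! / (n+beta+1)!  *)
Definition bweight (beta n : nat) : R :=
  (INR (fact n) * INR (fact (beta + 1)) / INR (fact (n + beta + 1)))%R.

(* Elements of A^2_beta are represented by their Taylor coefficient
   sequences a, the function being f_a(z) = sum_n a n z^n on the disc. *)
Definition inA2 (beta : nat) (a : nat -> C) : Prop :=
  ex_series (fun n => (bweight beta n * (Cmod (a n)) ^ 2)%R).

Definition eval_at (a : nat -> C) (z s : C) : Prop :=
  is_series (V := C_NormedModule) (fun n => a n * z ^ n) s.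

Definition inner (beta : nat) (a b : nat -> C) : C :=
  (Series (fun n => (bweight beta n * Re (a n * Cconj (b n)))%R),
   Series (fun n => (bweight beta n * Im (a n * Cconj (b n)))%R)).

Definition is_conjugation (beta : nat) (Cj : (nat -> C) -> (nat -> C)) : Prop :=
  (forall a, inA2 beta a -> inA2 beta (Cj a)) /\
  (forall a b (c : C), inA2 beta a -> inA2 beta b ->
     Cj (fun n => c * a n + b n) = (fun n => Cconj c * Cj a n + Cj b n)) /\
  (forall a, inA2 beta a -> Cj (Cj a) = a) /\
  (forall a b, inA2 beta a -> inA2 beta b ->
     inner beta (Cj a) (Cj b) = inner beta b a).

Definition is_adjoint (beta : nat) (T S : (nat -> C) -> (nat -> C)) : Prop :=
  (forall a, inA2 beta a -> inA2 beta (S a)) /\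
  (forall a b, inA2 beta a -> inA2 beta b ->
     inner beta (T a) b = inner beta a (S b)).

Definition complex_symmetric (beta : nat) (T : (nat -> C) -> (nat -> C)) : Prop :=
  exists Cj S, is_conjugation beta Cj /\ is_adjoint beta T S /\
    forall a, inA2 beta a -> Cj (T a) = S (Cj a).

Definition is_comp_op (beta : nat) (phi : C -> C) (T : (nat -> C) -> (nat -> C)) : Prop :=
  forall a, inA2 beta a ->
    inA2 beta (T a) /\
    forall z, in_disc z -> exists s, eval_at a (phi z) s /\ eval_at (T a) z s.

Definition phi_alpha (alpha z : C) : C := (alpha - z) / (1 - Cconj alpha * z).

(* Main.v *)
Require Import Defs.
From Stdlib Require Import Reals Arith Factorial Lra Lia FunctionalExtensionality List.
From Coquelicot Require Import Coquelicot.
Open Scope C_scope.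

(** Put k = beta + 2 and let K_w(z) = (1 - z conj w)^(-k) be the reproducing kernel. A conjugation
    intertwining T with its adjoint maps the eigenspaces of T isometrically onto those of T^*.  The
    iterates of phi are z |-> phi_alpha (lam^m phi_alpha z) and T^* K_w = K_(phi w), so the
    eigenspaces of T^* for 1 and conj lam^(k+1) are spanned by averages of kernels over phi-orbits.
    In the coordinates phi_alpha z, phi_alpha w, the kernel is, up to a factor, (1 - z conj w)^(-k)
    times a polynomial of degree k in z and in conj w, so it only couples frequencies at distance
    at most k modulo N; since N >= 2(k + 1), these two eigenspaces are orthogonal.  Hence so are the
    corresponding eigenspaces of T.  But the first contains the constant 1, and the second contains
    functions not vanishing at 0, because the N points of the phi-orbit of 0 are distinct and can be
    separated by polynomials. *)

(** * Finite complex sums *)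

Fixpoint csum (f : nat -> C) (n : nat) : C :=
  match n with O => 0 | S p => f p + csum f p end.

Lemma csum_ext (f g : nat -> C) (n : nat) :
  (forall m, (m < n)%nat -> f m = g m) -> csum f n = csum g n.
Proof.
  induction n as [|n IH]; intros H; simpl; [reflexivity|].
  rewrite H by lia. rewrite IH; auto with arith.
Qed.

Lemma csum_plus (f g : nat -> C) (n : nat) :
  csum (fun m => f m + g m) n = csum f n + csum g n.
Proof. induction n as [|n IH]; simpl; [ring|]. rewrite IH; ring. Qed.

Lemma csum_scal (c : C) (f : nat -> C) (n : nat) :
  csum (fun m => c * f m) n = c * csum f n.
Proof. induction n as [|n IH]; simpl; [ring|]. rewrite IH; ring. Qed.

Lemma csum_zero (f : nat -> C) (n : nat) :
  (forall m, (m < n)%nat -> f m = 0) -> csum f n = 0.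
Proof.
  intros H. rewrite (csum_ext f (fun _ => 0 * 0) n) by (intros; rewrite H; [ring|easy]).
  rewrite csum_scal; ring.
Qed.

Lemma csum_const (c : C) (n : nat) : csum (fun _ => c) n = INR n * c.
Proof.
  induction n as [|n IH]; [simpl; ring|].
  simpl csum. rewrite IH, S_INR, RtoC_plus; ring.
Qed.

Lemma csum_swap (f : nat -> nat -> C) (n p : nat) :
  csum (fun i => csum (fun j => f i j) p) n = csum (fun j => csum (fun i => f i j) n) p.
Proof.
  induction n as [|n IH]; simpl.
  - symmetry; now apply csum_zero.
  - rewrite IH, <- csum_plus; reflexivity.
Qed.

Lemma csum_conj (f : nat -> C) (n : nat) :
  Cconj (csum f n) = csum (fun m => Cconj (f m)) n.
Proof.
  induction n as [|n IH]; simpl.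
  - apply injective_projections; simpl; ring.
  - rewrite Cplus_conj, IH; reflexivity.
Qed.

Lemma csum_head (f : nat -> C) (n : nat) :
  csum f (S n) = f O + csum (fun m => f (S m)) n.
Proof.
  induction n as [|n IH]; [reflexivity|].
  change (csum f (S (S n))) with (f (S n) + csum f (S n)).
  rewrite IH; simpl; ring.
Qed.

Lemma csum_shift (f : nat -> C) (n : nat) :
  f n = f O -> csum (fun m => f (S m)) n = csum f n.
Proof.
  intros H. assert (E := csum_head f n). simpl in E. rewrite H in E.
  replace (csum (fun m => f (S m)) n) with (f O + csum (fun m => f (S m)) n - f O) by ring.
  rewrite <- E; ring.
Qed.

(** * Sums over the powers of a primitive root of unity *)

Section RootsOfUnity.
Variables (lam : C) (N : nat).
Hypotheses (hN : lam ^ N = 1) (hNmin : forall k : nat, (0 < k < N)%nat -> lam ^ k <> 1).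

(** Since [lam ^ N = 1], multiplication by [lam] permutes the powers of [lam] cyclically; the
    induction applies this shift [m] times. *)
Lemma csum_root_translate (F : C -> C) (m : nat) :
  csum (fun l => F (lam ^ l * lam ^ m)) N = csum (fun l => F (lam ^ l)) N.
Proof.
  induction m as [|m IH].
  - apply csum_ext; intros l _; f_equal; simpl; ring.
  - rewrite <- IH, <- (csum_shift (fun l => F (lam ^ l * lam ^ m))).
    + apply csum_ext; intros l _; f_equal; simpl; ring.
    + rewrite hN; reflexivity.
Qed.

(** Translating by [lam] leaves the sum unchanged and also multiplies it by [lam ^ e], which differs
    from 1. *)
Lemma csum_root_pow (e : nat) : (0 < e < N)%nat -> csum (fun m => (lam ^ m) ^ e) N = 0.
Proof.
  intros He.
  assert (E := csum_root_translate (fun x => x ^ e) 1).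
  simpl in E.
  assert (E' : lam ^ e * csum (fun m => (lam ^ m) ^ e) N = csum (fun m => (lam ^ m) ^ e) N).
  { rewrite <- E at 2. rewrite <- csum_scal. apply csum_ext; intros l _.
    rewrite Cmult_1_r, Cpow_mult_l; ring. }
  assert (D : lam ^ e - 1 <> 0).
  { intros H. apply (hNmin e He). replace (lam ^ e) with (lam ^ e - 1 + 1) by ring.
    rewrite H; ring. }
  generalize (csum (fun m => (lam ^ m) ^ e) N) E'; intros s Es.
  replace s with ((lam ^ e * s - s) / (lam ^ e - 1)) by (field; exact D).
  rewrite Es. field. exact D.
Qed.

(** Expanding the linear factors produces only powers of [lam ^ m] with exponents from [e] to
    [e + p + q], strictly between 0 and [N]. The induction removes one factor at a time, which keeps
    [e] or raises it by one. *)
Lemma csum_root_linear_factors (a b c d : C) (p q e : nat) :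
  (0 < e)%nat -> (e + p + q < N)%nat ->
  csum (fun m => (lam ^ m) ^ e * (a + b * lam ^ m) ^ p * (c + d * lam ^ m) ^ q) N = 0.
Proof.
  revert e q. induction p as [|p IHp].
  - intros e q; revert e. induction q as [|q IHq]; intros e He H.
    + rewrite <- (csum_root_pow e) by lia. apply csum_ext; intros; simpl; ring.
    + transitivity (c * 0 + d * 0); [|ring].
      rewrite <- (IHq e) at 1 by lia. rewrite <- (IHq (S e)) by lia.
      rewrite <- !csum_scal, <- csum_plus. apply csum_ext; intros; simpl; ring.
  - intros e q He H. transitivity (a * 0 + b * 0); [|ring].
    rewrite <- (IHp e q) at 1 by lia. rewrite <- (IHp (S e) q) by lia.
    rewrite <- !csum_scal, <- csum_plus. apply csum_ext; intros; simpl; ring.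
Qed.
End RootsOfUnity.

(** * The involutive disc automorphism [phi_alpha] *)

Lemma Cconj_mult_self (z : C) : z * Cconj z = RtoC (Cmod z ^ 2)%R.
Proof. symmetry; rewrite Cmod2_conj; reflexivity. Qed.

Lemma one_minus_neq0 (z : C) : (Cmod z < 1)%R -> 1 - z <> 0.
Proof.
  intros H E. assert (z = 1) by (replace z with (1 - (1 - z)) by ring; rewrite E; ring).
  subst z. rewrite Cmod_1 in H; lra.
Qed.

Lemma in_disc_mult_conj (z w : C) : in_disc z -> in_disc w -> in_disc (z * Cconj w).
Proof.
  unfold in_disc; intros Hz Hw. rewrite Cmod_mult, Cmod_conj.
  assert (A := Cmod_ge_0 z). assert (B := Cmod_ge_0 w). nra.
Qed.

Lemma phi_alpha_denom_neq0 (alpha z : C) :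
  in_disc alpha -> in_disc z -> 1 - Cconj alpha * z <> 0.
Proof.
  intros Ha Hz. rewrite Cmult_comm. apply one_minus_neq0, in_disc_mult_conj; assumption.
Qed.

Lemma phi_alpha_involutive (alpha z : C) :
  in_disc alpha -> in_disc z -> phi_alpha alpha (phi_alpha alpha z) = z.
Proof.
  intros Ha Hz. assert (D := phi_alpha_denom_neq0 alpha z Ha Hz).
  assert (D' := phi_alpha_denom_neq0 alpha alpha Ha Ha).
  unfold phi_alpha. field. split; [exact D|].
  replace (1 - Cconj alpha * z - Cconj alpha * (alpha - z)) with (1 - Cconj alpha * alpha) by ring.
  exact D'.
Qed.

(** This identity moves the kernel to the coordinate in which the automorphism is a rotation; its
    diagonal case shows that [phi_alpha] preserves the disc. *)
Lemma phi_alpha_kernel (alpha z w : C) :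
  in_disc alpha -> in_disc z -> in_disc w ->
  1 - phi_alpha alpha z * Cconj (phi_alpha alpha w) =
  (1 - Cconj alpha * alpha) * (1 - z * Cconj w) /
  ((1 - Cconj alpha * z) * (1 - alpha * Cconj w)).
Proof.
  intros Ha Hz Hw. assert (D := phi_alpha_denom_neq0 alpha z Ha Hz).
  assert (D' : 1 - alpha * Cconj w <> 0) by (apply one_minus_neq0, in_disc_mult_conj; assumption).
  unfold phi_alpha.
  rewrite Cdiv_conj by (apply phi_alpha_denom_neq0; assumption).
  rewrite !Cminus_conj, Cmult_conj, Cconj_conj.
  replace (Cconj 1) with (RtoC 1) by (apply injective_projections; simpl; ring).
  field. split; assumption.
Qed.

Lemma phi_alpha_in_disc (alpha z : C) :
  in_disc alpha -> in_disc z -> in_disc (phi_alpha alpha z).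
Proof.
  intros Ha Hz. assert (E := phi_alpha_kernel alpha z z Ha Hz Hz).
  assert (D := phi_alpha_denom_neq0 alpha z Ha Hz).
  (* On the diagonal the identity reads 1 - |phi_alpha z|^2 = (1 - |alpha|^2)(1 - |z|^2) / |1 -
     conj(alpha) z|^2, and the right-hand side is positive. *)
  replace (1 - alpha * Cconj z) with (Cconj (1 - Cconj alpha * z)) in E
    by (apply injective_projections; simpl; ring).
  rewrite (Cmult_comm (Cconj alpha) alpha), !Cconj_mult_self, <- !RtoC_minus, <- RtoC_mult in E.
  assert (P : (0 < Cmod (1 - Cconj alpha * z) ^ 2)%R) by (apply pow_lt, Cmod_gt_0, D).
  rewrite <- RtoC_div in E by lra. apply RtoC_inj in E.
  unfold in_disc in *. assert (A := Cmod_ge_0 alpha). assert (B := Cmod_ge_0 z).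
  assert (Q : (0 < (1 - Cmod alpha ^ 2) * (1 - Cmod z ^ 2))%R) by (apply Rmult_lt_0_compat; nra).
  apply (Rdiv_lt_0_compat _ _ Q) in P. rewrite <- E in P.
  assert (Z := Cmod_ge_0 (phi_alpha alpha z)). nra.
Qed.

(** * Polynomials with prescribed roots, used to separate points *)

Definition root_prod (L : list C) (x : C) : C := fold_right (fun p r => (x - p) * r) 1 L.

Lemma root_prod_root (L : list C) (x : C) : In x L -> root_prod L x = 0.
Proof.
  induction L as [|p L IH]; simpl; [easy|]. intros [->|H]; [|rewrite IH by assumption]; ring.
Qed.

Lemma root_prod_neq0 (L : list C) (x : C) : ~ In x L -> root_prod L x <> 0.
Proof.
  induction L as [|p L IH]; simpl; intros H.
  - intros E. apply RtoC_inj in E. lra.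
  - apply Cmult_neq_0; [|apply IH; tauto]. intros E. apply H; left.
    replace x with (x - p + p) by ring. rewrite E; ring.
Qed.

(** A linear functional that kills every monomial kills every polynomial. *)
Lemma csum_moments_root_prod (c x : nat -> C) (p : nat) (L : list C) :
  (forall n, csum (fun m => c m * x m ^ n) p = 0) ->
  csum (fun m => c m * root_prod L (x m)) p = 0.
Proof.
  (* The trivial power is inserted so that its exponent can be generalized: each factor x - r of the
     product raises it by one. *)
  intros H. transitivity (csum (fun m => c m * x m ^ 0 * root_prod L (x m)) p).
  { apply csum_ext; intros; simpl; ring. }
  generalize O as n. induction L as [|r L IH]; intros n.
  - rewrite <- (H n). apply csum_ext; intros; simpl; ring.
  - transitivity (csum (fun m => c m * x m ^ S n * root_prod L (x m)) p +
      - r * csum (fun m => c m * x m ^ n * root_prod L (x m)) p); [|rewrite !IH; ring].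
    rewrite <- csum_scal, <- csum_plus. apply csum_ext; intros; simpl; ring.
Qed.

(** * Complex series through their real and imaginary parts *)

Notation Cis_series := (is_series (V := C_NormedModule)).

Lemma sum_n_Re (f : nat -> C) (n : nat) :
  Re (sum_n (G := C_NormedModule) f n) = sum_n (fun m => Re (f m)) n.
Proof. induction n as [|n IH]; [now rewrite !sum_O|]. rewrite !sum_Sn, <- IH; reflexivity. Qed.

Lemma sum_n_Im (f : nat -> C) (n : nat) :
  Im (sum_n (G := C_NormedModule) f n) = sum_n (fun m => Im (f m)) n.
Proof. induction n as [|n IH]; [now rewrite !sum_O|]. rewrite !sum_Sn, <- IH; reflexivity. Qed.

(** Balls in [C] are products of real balls. This links complex series with [inner], which is a pair
    of real series. *)
Lemma Cis_series_pair (f : nat -> C) (x y : R) :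
  is_series (fun n => Re (f n)) x -> is_series (fun n => Im (f n)) y -> Cis_series f (x, y).
Proof.
  intros Hx Hy. apply filterlim_locally. intros eps.
  assert (Ex := proj1 (filterlim_locally _ _) Hx eps).
  assert (Ey := proj1 (filterlim_locally _ _) Hy eps).
  generalize (filter_and _ _ Ex Ey). apply filter_imp. intros n [A B].
  rewrite <- sum_n_Re in A. rewrite <- sum_n_Im in B. split; assumption.
Qed.

Lemma Cis_series_Re (f : nat -> C) (s : C) : Cis_series f s -> is_series (fun n => Re (f n)) (Re s).
Proof.
  intros H. apply filterlim_locally. intros eps.
  generalize (proj1 (filterlim_locally _ _) H eps). apply filter_imp. intros n [A B].
  rewrite <- sum_n_Re. exact A.
Qed.

Lemma Cis_series_Im (f : nat -> C) (s : C) : Cis_series f s -> is_series (fun n => Im (f n)) (Im s).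
Proof.
  intros H. apply filterlim_locally. intros eps.
  generalize (proj1 (filterlim_locally _ _) H eps). apply filter_imp. intros n [A B].
  rewrite <- sum_n_Im. exact B.
Qed.

Lemma Cis_series_eq (f : nat -> C) (s : C) :
  Cis_series f s -> (Series (fun n => Re (f n)), Series (fun n => Im (f n))) = s.
Proof.
  intros H. destruct s as [x y]. f_equal; apply is_series_unique.
  - exact (Cis_series_Re f (x, y) H).
  - exact (Cis_series_Im f (x, y) H).
Qed.

Lemma Cis_series_unique (f : nat -> C) (s t : C) : Cis_series f s -> Cis_series f t -> s = t.
Proof. intros Hs Ht. rewrite <- (Cis_series_eq f s Hs). now apply Cis_series_eq. Qed.

Lemma im_le_Cmod (z : C) : (Rabs (Im z) <= Cmod z)%R.
Proof. eapply Rle_trans; [apply Rmax_r|apply (Rmax_Cmod z)]. Qed.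

Lemma Cis_series_abs (f : nat -> C) :
  ex_series (fun n => Cmod (f n)) ->
  Cis_series f (Series (fun n => Re (f n)), Series (fun n => Im (f n))).
Proof.
  intros H. apply Cis_series_pair; apply Series_correct;
    apply (ex_series_le (V := R_CompleteNormedModule) _ (fun n => Cmod (f n))); trivial; intros n.
  - apply re_le_Cmod.
  - apply im_le_Cmod.
Qed.

Definition single (n : nat) (c : C) (i : nat) : C := if Nat.eqb i n then c else 0.

Lemma Cis_series_single (n : nat) (c : C) : Cis_series (single n c) c.
Proof.
  apply (filterlim_ext_loc (fun _ => c)); [|apply filterlim_const].
  exists n; intros m Hm; symmetry.
  assert (Z : forall p, (p < n)%nat ->
    sum_n (G := C_NormedModule) (single n c) p = RtoC 0).
  { induction p as [|p IH]; intros Hp.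
    - rewrite sum_O. unfold single. destruct (Nat.eqb_spec 0 n); [lia|reflexivity].
    - rewrite sum_Sn, IH by lia. unfold single. destruct (Nat.eqb_spec (S p) n); [lia|]. apply Cplus_0_l. }
  induction Hm as [|m Hm IH].
  - destruct n as [|n].
    + rewrite sum_O; reflexivity.
    + rewrite sum_Sn, Z by lia. unfold single. rewrite Nat.eqb_refl. apply Cplus_0_l.
  - rewrite sum_Sn, IH. unfold single. destruct (Nat.eqb_spec (S m) n); [lia|]. apply Cplus_0_r.
Qed.

(** With the powers of t absorbed into [a], the terms [b] are those of (1 - t) times the series of
    [a]. Absolute convergence ensures that [a] has a sum, which is then found by division. *)
Lemma Cis_series_divide (t B : C) (a b : nat -> C) :
  1 - t <> 0 -> ex_series (fun n => Cmod (a n)) -> Cis_series b B ->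
  b O = a O -> (forall n, b (S n) = a (S n) - t * a n) -> Cis_series a (B / (1 - t)).
Proof.
  intros Ht Ha Hb H0 HS. assert (Hs : exists s : C, Cis_series a s) by (eexists; now apply Cis_series_abs).
  destruct Hs as [s Hs].
  assert (E : Cis_series b (s - t * s)).
  (* [g] is [t * a] moved one place to the right, so [b] is the termwise difference of [a] and
     [g]. *)
  { pose (g := fun n : nat => match n return C with O => 0 | S m => t * a m end).
    assert (G : Cis_series g (t * s)).
    { apply is_series_decr_1. simpl.
      match goal with |- Cis_series _ ?p => replace p with (t * s) end.
      2: change (t * s = t * s + - 0); ring.
      exact (is_series_scal (V := C_NormedModule) t a s Hs). }
    apply (is_series_ext (fun n => minus (a n) (g n))).
    - intros [|n]; simpl; [rewrite H0|rewrite HS].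
      + change (a O - 0 = a O); ring.
      + reflexivity.
    - exact (is_series_minus (V := C_NormedModule) a g s (t * s) Hs G). }
  rewrite (Cis_series_unique b B _ Hb E).
  replace ((s - t * s) / (1 - t)) with s by (field; exact Ht). exact Hs.
Qed.

(** * The negative binomial series *)

(** The binomial coefficient of n + k over k, which is the coefficient of t^n in (1 - t)^(-(k +
    1)). *)
Definition cbin (k n : nat) : R := (INR (fact (n + k)) / (INR (fact n) * INR (fact k)))%R.

Lemma cbin_pos (k n : nat) : (0 < cbin k n)%R.
Proof. apply Rdiv_lt_0_compat; [|apply Rmult_lt_0_compat]; apply INR_fact_lt_0. Qed.

Lemma cbin_ratio (k n : nat) : (cbin k (S n) = cbin k n * (1 + INR k * / INR (S n)))%R.
Proof.
  unfold cbin. simpl Nat.add. rewrite !fact_simpl, !mult_INR, !S_INR, plus_INR.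
  assert (A := INR_fact_neq_0 n). assert (B := INR_fact_neq_0 k). assert (D := pos_INR n).
  field. repeat split; trivial; lra.
Qed.

Lemma cbin_pascal (k n : nat) : (cbin k (S n) = cbin (S k) (S n) - cbin (S k) n)%R.
Proof.
  unfold cbin. replace (S n + S k)%nat with (S (S (n + k))) by lia.
  replace (n + S k)%nat with (S (n + k)) by lia. simpl Nat.add.
  rewrite !fact_simpl, !mult_INR, !S_INR, plus_INR.
  assert (A := INR_fact_neq_0 n). assert (B := INR_fact_neq_0 k).
  assert (D := pos_INR n). assert (E := pos_INR k).
  field. repeat split; trivial; lra.
Qed.

Lemma cbin_0_r (k : nat) : cbin k 0 = 1%R.
Proof. unfold cbin; simpl. field. apply INR_fact_neq_0. Qed.

Lemma cbin_0_l (n : nat) : cbin 0 n = 1%R.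
Proof. unfold cbin. rewrite Nat.add_0_r; simpl. field. apply INR_fact_neq_0. Qed.

(** Ratio test: consecutive coefficients have ratio 1 + k/(n + 1), which tends to 1. *)
Lemma cbin_abs_series (k : nat) (r : R) :
  (Rabs r < 1)%R -> ex_series (fun n => Rabs (cbin k n * r ^ n)%R).
Proof.
  intros Hr. apply (CV_disk_DAlembert (cbin k) r 1).
  - intros n H. assert (A := cbin_pos k n). lra.
  - apply (is_lim_seq_ext (fun n => (1 + INR k * / INR (S n))%R)).
    + intros n. rewrite cbin_ratio. assert (A := cbin_pos k n).
      assert (B := pos_INR k). assert (D : (0 < / INR (S n))%R) by (apply Rinv_0_lt_compat, lt_0_INR; lia).
      rewrite Rabs_right; [field; split; [apply not_0_INR; lia|lra]|].
      replace (cbin k n * (1 + INR k * / INR (S n)) / cbin k n)%R with (1 + INR k * / INR (S n))%R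
        by (field; split; [apply not_0_INR; lia|lra]).
      nra.
    + replace (Finite 1) with (Finite (1 + INR k * 0)) by (f_equal; ring).
      apply is_lim_seq_plus'; [apply is_lim_seq_const|].
      apply is_lim_seq_mult'; [apply is_lim_seq_const|].
      apply (is_lim_seq_incr_1 (fun n => / INR n)%R).
      replace (Finite 0) with (Rbar_inv p_infty) by reflexivity.
      apply is_lim_seq_inv; [apply is_lim_seq_INR|discriminate].
  - right. split; lra.
Qed.

Lemma cbin_Cabs_series (k : nat) (t : C) :
  (Cmod t < 1)%R -> ex_series (fun n => Cmod (cbin k n * t ^ n)).
Proof.
  intros Ht. eapply ex_series_ext; [|apply (cbin_abs_series k (Cmod t))].
  - intros n; simpl. rewrite Cmod_mult, Cmod_R, Cmod_pow, Rabs_mult.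
    f_equal. apply Rabs_right, Rle_ge, pow_le, Cmod_ge_0.
  - rewrite Rabs_right; [assumption|apply Rle_ge, Cmod_ge_0].
Qed.

(** Induction on [k] from the geometric series: by Pascal's rule, passing from [k] to [k + 1]
    amounts to dividing by 1 - t. *)
Lemma binomial_series (k : nat) (t : C) :
  (Cmod t < 1)%R -> Cis_series (fun n => cbin k n * t ^ n) (/ (1 - t) ^ (S k)).
Proof.
  intros Ht. assert (D := one_minus_neq0 t Ht).
  induction k as [|k IH].
  - replace (/ (1 - t) ^ 1) with (1 / (1 - t)) by (simpl; field; exact D).
    apply (Cis_series_divide t 1 _ (single 0 1)); trivial.
    + now apply cbin_Cabs_series.
    + apply Cis_series_single.
    + rewrite cbin_0_l; unfold single; simpl; ring.
    + intros n. rewrite !cbin_0_l; unfold single; simpl; ring.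
  - replace (/ (1 - t) ^ S (S k)) with (/ (1 - t) ^ S k / (1 - t))
      by (simpl; field; split; [apply Cpow_nz|]; exact D).
    eapply Cis_series_divide; [exact D|now apply cbin_Cabs_series|exact IH| |].
    + simpl. now rewrite !cbin_0_r.
    + intros n; simpl. rewrite cbin_pascal, RtoC_minus; ring.
Qed.

(** The weights are inverse to the coefficients of (1 - t)^(-(beta + 2)); this is why that power
    gives the reproducing kernel. *)
Lemma bweight_cbin (beta n : nat) : (bweight beta n * cbin (beta + 1) n = 1)%R.
Proof.
  unfold bweight, cbin. rewrite Nat.add_assoc.
  assert (A := INR_fact_neq_0 n). assert (B := INR_fact_neq_0 (beta + 1)).
  assert (D := INR_fact_neq_0 (n + beta + 1)). field. repeat split; assumption.
Qed.

Lemma bweight_pos (beta n : nat) : (0 < bweight beta n)%R.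
Proof. assert (A := bweight_cbin beta n). assert (B := cbin_pos (beta + 1) n). nra. Qed.

(** * The Hilbert space [inA2 beta] and its inner product *)

Section Space.
Variable beta : nat.
Notation A2 := (inA2 beta).
Notation ip := (inner beta).
Notation zero_seq := (fun _ : nat => RtoC 0).

Definition ip_term (a b : nat -> C) (n : nat) : C := bweight beta n * (a n * Cconj (b n)).

Lemma Cmod_ip_term (a b : nat -> C) (n : nat) :
  Cmod (ip_term a b n) = (bweight beta n * (Cmod (a n) * Cmod (b n)))%R.
Proof.
  unfold ip_term. rewrite !Cmod_mult, Cmod_conj, Cmod_R, Rabs_right; [reflexivity|].
  apply Rle_ge, Rlt_le, bweight_pos.
Qed.

(** Domination by the sum of the two norm series, as |x||y| <= |x|^2 + |y|^2. *)
Lemma ip_term_abs_series (a b : nat -> C) :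
  A2 a -> A2 b -> ex_series (fun n => Cmod (ip_term a b n)).
Proof.
  intros Ha Hb.
  apply (ex_series_le (V := R_CompleteNormedModule) _ (fun n =>
    plus (bweight beta n * Cmod (a n) ^ 2)%R (bweight beta n * Cmod (b n) ^ 2)%R)).
  - intros n. change (Rabs (Cmod (ip_term a b n)) <=
      bweight beta n * Cmod (a n) ^ 2 + bweight beta n * Cmod (b n) ^ 2)%R.
    rewrite Rabs_right by apply Rle_ge, Cmod_ge_0. rewrite Cmod_ip_term.
    assert (W := bweight_pos beta n).
    rewrite <- Rmult_plus_distr_l. apply Rmult_le_compat_l; [lra|].
    assert (X := pow2_ge_0 (Cmod (a n) - Cmod (b n))).
    assert (Y := Rmult_le_pos _ _ (Cmod_ge_0 (a n)) (Cmod_ge_0 (b n))). nra.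
  - exact (ex_series_plus (V := R_NormedModule) _ _ Ha Hb).
Qed.

Lemma inner_is_series (a b : nat -> C) : A2 a -> A2 b -> Cis_series (ip_term a b) (ip a b).
Proof.
  intros Ha Hb. assert (H := Cis_series_abs _ (ip_term_abs_series a b Ha Hb)).
  replace (ip a b) with (Series (fun n => Re (ip_term a b n)), Series (fun n => Im (ip_term a b n)));
    [exact H|].
  unfold inner, ip_term; f_equal; apply Series_ext; intros n; simpl; ring.
Qed.

Lemma inA2_lin (a b : nat -> C) (c : C) : A2 a -> A2 b -> A2 (fun n => c * a n + b n).
Proof.
  intros Ha Hb. unfold inA2.
  apply (ex_series_le (V := R_CompleteNormedModule) _ (fun n =>
    plus (scal (2 * Cmod c ^ 2)%R (bweight beta n * Cmod (a n) ^ 2)%R)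
      (scal 2%R (bweight beta n * Cmod (b n) ^ 2)%R))).
  - intros n. change (Rabs (bweight beta n * Cmod (c * a n + b n) ^ 2) <=
      2 * Cmod c ^ 2 * (bweight beta n * Cmod (a n) ^ 2) + 2 * (bweight beta n * Cmod (b n) ^ 2))%R.
    assert (W := bweight_pos beta n).
    rewrite Rabs_right by (apply Rle_ge, Rmult_le_pos; [lra|apply pow2_ge_0]).
    assert (T := Cmod_triangle (c * a n) (b n)). rewrite Cmod_mult in T.
    assert (P := Cmod_ge_0 (c * a n + b n)).
    assert (Q : (Cmod (c * a n + b n) ^ 2 <= 2 * (Cmod c * Cmod (a n)) ^ 2 + 2 * Cmod (b n) ^ 2)%R).
    { apply Rle_trans with ((Cmod c * Cmod (a n) + Cmod (b n)) ^ 2)%R.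
      - apply pow_incr; split; assumption.
      - assert (X := pow2_ge_0 (Cmod c * Cmod (a n) - Cmod (b n))). nra. }
    apply Rmult_le_compat_l with (r := bweight beta n) in Q; [|lra]. nra.
  - apply (ex_series_plus (V := R_NormedModule));
      apply (ex_series_scal (V := R_NormedModule)); assumption.
Qed.

Lemma inA2_single (n : nat) (c : C) : A2 (single n c).
Proof.
  exists (Re (RtoC (bweight beta n * Cmod c ^ 2))).
  apply (is_series_ext (fun i => Re (single n (RtoC (bweight beta n * Cmod c ^ 2)) i))).
  - intros i. unfold single. destruct (Nat.eqb_spec i n) as [->|_]; [reflexivity|].
    rewrite Cmod_0; simpl; ring.
  - apply Cis_series_Re, Cis_series_single.
Qed.

Lemma inA2_zero : A2 zero_seq.
Proof.
  eapply ex_series_ext; [|apply (inA2_single 0 0)].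
  intros n. unfold single. now destruct (Nat.eqb n 0).
Qed.

Lemma inner_lin_l (a b d : nat -> C) (c : C) :
  A2 a -> A2 b -> A2 d -> ip (fun n => c * a n + b n) d = c * ip a d + ip b d.
Proof.
  intros Ha Hb Hd.
  apply (Cis_series_unique (ip_term (fun n => c * a n + b n) d)).
  - apply inner_is_series; trivial. now apply inA2_lin.
  - apply (is_series_ext (fun n => plus (scal c (ip_term a d n)) (ip_term b d n))).
    + intros n. change (c * ip_term a d n + ip_term b d n = ip_term (fun n => c * a n + b n) d n).
      unfold ip_term; ring.
    + apply (is_series_plus (V := C_NormedModule) _ _ (scal c (ip a d)) (ip b d)).
      * apply (is_series_scal (V := C_NormedModule)), inner_is_series; assumption.
      * apply inner_is_series; assumption.
Qed.

Lemma inner_conj (a b : nat -> C) : ip b a = Cconj (ip a b).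
Proof.
  unfold inner, Cconj; simpl; f_equal.
  - apply Series_ext; intros n; simpl; ring.
  - rewrite <- Series_opp. apply Series_ext; intros n; simpl; ring.
Qed.

Lemma inner_zero_l (b : nat -> C) : ip zero_seq b = 0.
Proof.
  unfold inner. apply injective_projections; simpl;
    rewrite (Series_ext _ (fun _ => 0 * 0)%R) by (intros n; simpl; ring);
    rewrite Series_scal_l; ring.
Qed.

(** * Finite linear combinations *)

(** Each step has the shape c * a + b of the linearity clause in [is_conjugation], so that clause
    applies without rearrangement. *)
Fixpoint lcomb (c : nat -> C) (A : nat -> nat -> C) (p : nat) : nat -> C :=
  match p with
  | O => zero_seq
  | S q => fun n => c q * A q n + lcomb c A q n
  end.

Lemma inA2_lcomb (c : nat -> C) (A : nat -> nat -> C) (p : nat) :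
  (forall m, (m < p)%nat -> A2 (A m)) -> A2 (lcomb c A p).
Proof.
  induction p as [|p IH]; intros H; [apply inA2_zero|].
  apply inA2_lin; [apply H; lia|]. apply IH; auto with arith.
Qed.

Lemma inner_lcomb_l (c : nat -> C) (A : nat -> nat -> C) (b : nat -> C) (p : nat) :
  (forall m, (m < p)%nat -> A2 (A m)) -> A2 b ->
  ip (lcomb c A p) b = csum (fun m => c m * ip (A m) b) p.
Proof.
  intros H Hb; revert H. induction p as [|p IH]; intros H; [apply inner_zero_l|].
  cbn [lcomb csum]. rewrite inner_lin_l, IH; auto with arith. apply inA2_lcomb; auto with arith.
Qed.

Lemma inner_lcomb_r (c : nat -> C) (A : nat -> nat -> C) (b : nat -> C) (p : nat) :
  (forall m, (m < p)%nat -> A2 (A m)) -> A2 b ->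
  ip b (lcomb c A p) = csum (fun m => Cconj (c m) * ip b (A m)) p.
Proof.
  intros H Hb. rewrite inner_conj, inner_lcomb_l, csum_conj by assumption.
  apply csum_ext; intros m _. rewrite Cmult_conj, <- inner_conj; reflexivity.
Qed.

Lemma conjugation_lcomb (Cj : (nat -> C) -> nat -> C) (c : nat -> C) (A : nat -> nat -> C) (p : nat) :
  is_conjugation beta Cj -> (forall m, (m < p)%nat -> A2 (A m)) ->
  Cj (lcomb c A p) = lcomb (fun m => Cconj (c m)) (fun m => Cj (A m)) p.
Proof.
  intros (_ & HL & _ & _) H. induction p as [|p IH].
  (* Conjugate-linearity with scalar -1 on zero sequences gives Cj 0 = - Cj 0 + Cj 0, hence Cj 0 =
     0. *)
  - simpl. assert (E := HL zero_seq zero_seq (-1) inA2_zero inA2_zero).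
    assert (Z : (fun n : nat => -1 * zero_seq n + zero_seq n) = zero_seq)
      by (apply functional_extensionality; intros n; ring).
    cbv beta in E, Z. rewrite Z in E.
    rewrite E. apply functional_extensionality; intros n.
    apply injective_projections; simpl; ring.
  - cbn [lcomb]. rewrite HL, IH; auto with arith. apply inA2_lcomb; auto with arith.
Qed.

(** * Reproducing kernels *)

(** Taylor coefficients of z |-> (1 - z conj(w))^(-(beta + 2)). *)
Definition kernel (w : C) (n : nat) : C := cbin (beta + 1) n * Cconj w ^ n.

Lemma inA2_kernel (w : C) : in_disc w -> A2 (kernel w).
Proof.
  intros Hw. eapply ex_series_ext; [|apply (cbin_abs_series (beta + 1) (Cmod w ^ 2))].
  - intros n. match goal with |- ?x = ?y => change (@eq R x y) end. unfold kernel. rewrite Cmod_mult, Cmod_R, Cmod_pow, Cmod_conj.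
    assert (P := cbin_pos (beta + 1) n).
    rewrite (Rabs_right (cbin (beta + 1) n)) by lra.
    rewrite Rabs_right by (apply Rle_ge, Rmult_le_pos; [lra|apply pow_le, pow2_ge_0]).
    rewrite <- pow_mult, Nat.mul_comm, pow_mult.
    transitivity (bweight beta n * cbin (beta + 1) n * cbin (beta + 1) n * (Cmod w ^ n) ^ 2)%R.
    + rewrite bweight_cbin; ring.
    + ring.
  - unfold in_disc in Hw. assert (P := Cmod_ge_0 w).
    rewrite Rabs_right; [|apply Rle_ge, pow2_ge_0]. nra.
Qed.

Lemma ip_term_kernel (a : nat -> C) (z : C) (n : nat) : ip_term a (kernel z) n = a n * z ^ n.
Proof.
  unfold ip_term, kernel. rewrite Cmult_conj, <- Cpow_conj, Cconj_conj.
  replace (Cconj (cbin (beta + 1) n)) with (RtoC (cbin (beta + 1) n))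
    by (apply injective_projections; simpl; ring).
  transitivity (RtoC (bweight beta n * cbin (beta + 1) n) * (a n * z ^ n)).
  - rewrite RtoC_mult; ring.
  - rewrite bweight_cbin; ring.
Qed.

(** The weight cancels the binomial coefficient, so the inner product is termwise the power series.
    Point evaluation is written as a pairing with [kernel] from here on. *)
Lemma eval_at_kernel (a : nat -> C) (z : C) : A2 a -> in_disc z -> eval_at a z (ip a (kernel z)).
Proof.
  intros Ha Hz. eapply is_series_ext; [|apply inner_is_series; [exact Ha|now apply inA2_kernel]].
  intros n. apply ip_term_kernel.
Qed.

Lemma inner_kernel_kernel (w z : C) :
  in_disc w -> in_disc z -> ip (kernel w) (kernel z) = / (1 - z * Cconj w) ^ (beta + 2).
Proof.
  intros Hw Hz. apply (Cis_series_unique (fun n => kernel w n * z ^ n)).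
  - apply eval_at_kernel; [apply inA2_kernel|]; assumption.
  - replace (beta + 2)%nat with (S (beta + 1)) by lia.
    eapply is_series_ext; [|apply binomial_series; now apply in_disc_mult_conj].
    intros n; simpl. unfold kernel. rewrite Cpow_mult_l; ring.
Qed.

Lemma inner_single_kernel (n : nat) (z : C) :
  in_disc z -> ip (single n 1) (kernel z) = z ^ n.
Proof.
  intros Hz. apply (Cis_series_unique (fun i => single n 1 i * z ^ i)).
  - apply eval_at_kernel; [apply inA2_single|assumption].
  - eapply is_series_ext; [|apply (Cis_series_single n (z ^ n))].
    intros i; unfold single; simpl. destruct (Nat.eqb_spec i n) as [->|_]; ring.
Qed.

Lemma zero_of_eval_real (a : nat -> R) :
  CV_disk a (/ 2) -> (forall x, (Rabs x < 1)%R -> is_series (fun n => a n * x ^ n)%R 0%R) ->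
  forall n, a n = 0%R.
Proof.
  (* The radius of convergence is a supremum over [CV_disk], hence at least 1/2; being positive, it
     lets the values determine the coefficients. *)
  intros Hd H n. assert (L := proj1 (Lub_Rbar_correct (CV_disk a)) (/ 2)%R Hd).
  apply (PSeries_ext_recip a (fun _ => 0%R)).
  - eapply Rbar_lt_le_trans; [|exact L]. simpl; lra.
  - rewrite CV_radius_const_0; exact I.
  - exists (mkposreal 1 Rlt_0_1). intros x Hx.
    change (Rabs (x + - 0) < 1)%R in Hx. rewrite Ropp_0, Rplus_0_r in Hx.
    rewrite PSeries_const_0. apply is_series_unique, H, Hx.
Qed.

(** Real points suffice: there the real and imaginary parts of the coefficients define two real
    power series, both with sum 0. *)
Lemma eq_zero_of_eval (a : nat -> C) :
  A2 a -> (forall z, in_disc z -> ip a (kernel z) = 0) -> a = zero_seq.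
Proof.
  intros Ha H.
  assert (Hh : in_disc (RtoC (/ 2))).
  { unfold in_disc. rewrite Cmod_R, Rabs_right; lra. }
  assert (Hs := ip_term_abs_series a _ Ha (inA2_kernel _ Hh)).
  assert (E : forall x, (Rabs x < 1)%R -> eval_at a (RtoC x) 0).
  { intros x Hx. assert (Dx : in_disc x) by (unfold in_disc; now rewrite Cmod_R).
    rewrite <- (H x Dx). now apply eval_at_kernel. }
  apply functional_extensionality; intros n. apply injective_projections; simpl.
  - apply (zero_of_eval_real (fun n => Re (a n))).
    + apply (ex_series_le (V := R_CompleteNormedModule) _ _) with (2 := Hs). intros m.
      change (Rabs (Rabs (Re (a m) * (/ 2) ^ m)) <= Cmod (ip_term a (kernel (/ 2)%R) m))%R.
      rewrite Rabs_Rabsolu, ip_term_kernel, <- RtoC_pow.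
      eapply Rle_trans; [|apply re_le_Cmod]. right; f_equal; unfold Re, Im; simpl; ring.
    + intros x Hx. eapply is_series_ext; [|exact (Cis_series_Re _ _ (E x Hx))].
      intros m; simpl. rewrite <- RtoC_pow; unfold Re, Im; simpl; ring.
  - apply (zero_of_eval_real (fun n => Im (a n))).
    + apply (ex_series_le (V := R_CompleteNormedModule) _ _) with (2 := Hs). intros m.
      change (Rabs (Rabs (Im (a m) * (/ 2) ^ m)) <= Cmod (ip_term a (kernel (/ 2)%R) m))%R.
      rewrite Rabs_Rabsolu, ip_term_kernel, <- RtoC_pow.
      eapply Rle_trans; [|apply im_le_Cmod]. right; f_equal; unfold Re, Im; simpl; ring.
    + intros x Hx. eapply is_series_ext; [|exact (Cis_series_Im _ _ (E x Hx))].
      intros m; simpl. rewrite <- RtoC_pow; unfold Re, Im; simpl; ring.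
Qed.
End Space.

Lemma eq_of_eval (beta : nat) (a b : nat -> C) :
  inA2 beta a -> inA2 beta b ->
  (forall z, in_disc z -> inner beta a (kernel beta z) = inner beta b (kernel beta z)) -> a = b.
Proof.
  intros Ha Hb H.
  assert (E := eq_zero_of_eval beta (fun n => -1 * a n + b n) (inA2_lin beta a b (-1) Ha Hb)).
  apply functional_extensionality; intros n.
  replace (b n) with (a n + (-1 * a n + b n)) by ring.
  change (a n = a n + (fun n => -1 * a n + b n) n).
  rewrite E; [ring|]. intros z Hz.
  rewrite inner_lin_l, H; trivial; [ring|now apply inA2_kernel].
Qed.

(** * Iterates of the elliptic automorphism and orbit sums of kernels *)

Section Elliptic.
Variables (beta : nat) (alpha lam : C) (N : nat).
Hypotheses (halpha0 : alpha <> 0) (halpha : in_disc alpha)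
  (hlam : Cmod lam = 1%R) (hN0 : (0 < N)%nat) (hN : lam ^ N = 1)
  (hNmin : forall k : nat, (0 < k < N)%nat -> lam ^ k <> 1)
  (hNbig : (2 * (3 + beta) <= N)%nat).

Definition phi_iter (m : nat) (z : C) : C := phi_alpha alpha (lam ^ m * phi_alpha alpha z).

Lemma rotation_in_disc (m : nat) (z : C) : in_disc z -> in_disc (lam ^ m * z).
Proof. unfold in_disc. rewrite Cmod_mult, Cmod_pow, hlam, pow1, Rmult_1_l; trivial. Qed.

Lemma phi_iter_in_disc (m : nat) (z : C) : in_disc z -> in_disc (phi_iter m z).
Proof.
  intros Hz. apply phi_alpha_in_disc, rotation_in_disc, phi_alpha_in_disc; assumption.
Qed.

Lemma phi_iter_comp (m p : nat) (z : C) :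
  in_disc z -> phi_iter m (phi_iter p z) = phi_iter (m + p) z.
Proof.
  intros Hz. unfold phi_iter. rewrite phi_alpha_involutive, Cpow_add_r, Cmult_assoc; trivial.
  apply rotation_in_disc, phi_alpha_in_disc; assumption.
Qed.

Lemma lam_pow_conj (m : nat) : lam ^ m * Cconj (lam ^ m) = 1.
Proof. rewrite Cconj_mult_self, Cmod_pow, hlam, !pow1; reflexivity. Qed.

(** As |lam| = 1, the factor [(lam ^ m) ^ (beta + 2)] turns each 1 - alpha conj(lam^m y) into lam^m
    - alpha conj(y), making the term polynomial in [lam ^ m]. The remaining [lam ^ m] keeps all
    exponents positive. *)
Lemma kernel_orbit_term (l m : nat) (x y : C) :
  in_disc x -> in_disc y ->
  lam ^ m * (lam ^ m) ^ (beta + 2) *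
    / (1 - phi_alpha alpha (lam ^ l * lam ^ m * x) * Cconj (phi_alpha alpha (lam ^ m * y)))
      ^ (beta + 2) =
  (/ ((1 - Cconj alpha * alpha) * (1 - lam ^ l * x * Cconj y))) ^ (beta + 2) *
    ((lam ^ m) ^ 1 * (1 + - (Cconj alpha * lam ^ l * x) * lam ^ m) ^ (beta + 2) *
     (- (alpha * Cconj y) + 1 * lam ^ m) ^ (beta + 2)).
Proof.
  intros Hx Hy. assert (U := lam_pow_conj m).
  assert (HX : in_disc (lam ^ l * lam ^ m * x))
    by (rewrite <- Cmult_assoc; now apply rotation_in_disc, rotation_in_disc).
  assert (HY := rotation_in_disc m y Hy).
  assert (D1 := phi_alpha_denom_neq0 alpha _ halpha HX).
  assert (D2 : 1 - alpha * Cconj (lam ^ m * y) <> 0)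
    by (apply one_minus_neq0, in_disc_mult_conj; assumption).
  assert (D3 := phi_alpha_denom_neq0 alpha alpha halpha halpha).
  assert (D4 : 1 - lam ^ l * x * Cconj y <> 0)
    by (apply one_minus_neq0, in_disc_mult_conj; [now apply rotation_in_disc|assumption]).
  rewrite <- Cpow_inv by (apply one_minus_neq0, in_disc_mult_conj; now apply phi_alpha_in_disc).
  rewrite phi_alpha_kernel by assumption.
  rewrite Cmult_conj in *.
  replace (lam ^ l * lam ^ m * x * (Cconj (lam ^ m) * Cconj y))
    with (lam ^ l * x * Cconj y * (lam ^ m * Cconj (lam ^ m))) by ring.
  rewrite U, Cmult_1_r.
  replace (- (alpha * Cconj y) + 1 * lam ^ m)
    with (lam ^ m * (1 - alpha * (Cconj (lam ^ m) * Cconj y)))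
    by (transitivity (lam ^ m - alpha * Cconj y * (lam ^ m * Cconj (lam ^ m)));
        [ring|rewrite U; ring]).
  (* Apart from one factor [t], both sides are [k]-th powers, so comparing their bases is enough. *)
  match goal with |- ?t * ?t ^ ?k * ?Z ^ ?k = ?A ^ ?k * (?t ^ 1 * ?P ^ ?k * ?Q ^ ?k) =>
    transitivity (t * (t * Z) ^ k); [rewrite (Cpow_mult_l t Z k); ring|];
    transitivity (t * (A * P * Q) ^ k); [|rewrite !Cpow_mult_l, Cpow_1_r; ring];
    replace (t * Z) with (A * P * Q); [reflexivity|]
  end.
  field. repeat split; trivial.
Qed.

(* Substituting [z, w] by [phi_alpha] images and rotating the sum over [l] by [lam ^ m] leaves, for
   each [l], a polynomial in [lam ^ m] whose exponents lie between [1] and [2 (beta + 2) + 1 < N]. *)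
Lemma kernel_orbit_sum (w z : C) :
  in_disc w -> in_disc z ->
  csum (fun l => csum (fun m => (lam ^ m) ^ (beta + 3) *
    / (1 - phi_iter l w * Cconj (phi_iter m z)) ^ (beta + 2)) N) N = 0.
Proof.
  intros Hw Hz. assert (Hx := phi_alpha_in_disc alpha w halpha Hw).
  assert (Hy := phi_alpha_in_disc alpha z halpha Hz).
  rewrite csum_swap.
  transitivity (csum (fun m => csum (fun l =>
    (/ ((1 - Cconj alpha * alpha) * (1 - lam ^ l * phi_alpha alpha w * Cconj (phi_alpha alpha z))))
      ^ (beta + 2) *
    ((lam ^ m) ^ 1 * (1 + - (Cconj alpha * lam ^ l * phi_alpha alpha w) * lam ^ m) ^ (beta + 2) *
     (- (alpha * Cconj (phi_alpha alpha z)) + 1 * lam ^ m) ^ (beta + 2))) N) N).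
  - apply csum_ext; intros m _. unfold phi_iter.
    rewrite <- (csum_root_translate lam N hN (fun t => (lam ^ m) ^ (beta + 3) *
      / (1 - phi_alpha alpha (t * phi_alpha alpha w) *
             Cconj (phi_alpha alpha (lam ^ m * phi_alpha alpha z))) ^ (beta + 2)) m).
    apply csum_ext; intros l _. rewrite <- kernel_orbit_term by assumption.
    replace (beta + 3)%nat with (S (beta + 2)) by lia. reflexivity.
  - rewrite csum_swap. apply csum_zero; intros l _. rewrite csum_scal.
    rewrite (csum_root_linear_factors lam N hN hNmin) by lia. ring.
Qed.

(** Applying [phi_alpha] carries the orbit of 0 to the points lam^m alpha, and alpha is nonzero. *)
Lemma phi_iter_0_inj (m : nat) : (0 < m < N)%nat -> phi_iter m 0 <> phi_iter 0 0.
Proof.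
  intros Hm E. assert (D0 : in_disc 0) by (unfold in_disc; rewrite Cmod_0; lra).
  assert (Hx := phi_alpha_in_disc alpha 0 halpha D0).
  apply (f_equal (phi_alpha alpha)) in E. unfold phi_iter in E.
  rewrite !phi_alpha_involutive in E by (trivial; now apply rotation_in_disc).
  replace (phi_alpha alpha 0) with alpha in E
    by (unfold phi_alpha; field; replace (1 - Cconj alpha * 0) with (RtoC 1) by ring;
        apply C1_nz).
  apply (hNmin m Hm). replace (lam ^ m) with (lam ^ m * alpha / alpha) by (field; trivial).
  rewrite E; simpl; field; trivial.
Qed.

(** * The composition operator and the contradiction *)

Section Operator.
Variable T : (nat -> C) -> (nat -> C).
Hypothesis hT : is_comp_op beta (fun z => phi_alpha alpha (lam * phi_alpha alpha z)) T.
Notation A2 := (inA2 beta).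
Notation ip := (inner beta).
Notation K := (kernel beta).

Lemma comp_op_iter (m : nat) (a : nat -> C) :
  A2 a -> A2 (Nat.iter m T a) /\
    forall z, in_disc z -> ip (Nat.iter m T a) (K z) = ip a (K (phi_iter m z)).
Proof.
  intros Ha. induction m as [|m [IA IE]].
  - split; [exact Ha|]. intros z Hz. unfold phi_iter; simpl.
    rewrite Cmult_1_l, phi_alpha_involutive; trivial.
  - destruct (hT _ IA) as [HA HE]. split; [exact HA|]. intros z Hz.
    destruct (HE z Hz) as (s & H1 & H2).
    assert (E1 : phi_alpha alpha (lam * phi_alpha alpha z) = phi_iter 1 z)
      by (unfold phi_iter; rewrite Cpow_1_r; reflexivity).
    rewrite E1 in H1.
    replace (phi_iter (S m) z) with (phi_iter m (phi_iter 1 z))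
      by (rewrite phi_iter_comp by assumption; f_equal; lia).
    rewrite <- IE by now apply phi_iter_in_disc.
    simpl. rewrite (Cis_series_unique _ _ _ (eval_at_kernel beta _ z HA Hz) H2).
    apply (Cis_series_unique _ _ _ H1), eval_at_kernel; trivial. now apply phi_iter_in_disc.
Qed.

Notation coef := (fun m => Cconj ((lam ^ m) ^ (beta + 3))).

(* Up to the factor [N], the left-hand side is the projection of [u] onto the
   [lam ^ (beta + 3)]-eigenspace of [T], while [u] is fixed by the adjoint. *)
Lemma projection_adjoint_fixed_eq0 (u : nat -> C) :
  A2 u -> (forall a, A2 a -> ip (T a) u = ip a u) ->
  lcomb coef (fun m => Nat.iter m T u) N = (fun _ => RtoC 0).
Proof.
  intros Hu Hfix.
  assert (HTu : forall m, A2 (Nat.iter m T u)) by (intros m; now apply comp_op_iter).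
  apply (eq_zero_of_eval beta); [apply inA2_lcomb; auto|]. intros z Hz.
  rewrite inner_lcomb_l; auto; [|now apply inA2_kernel].
  (* [q] represents the functional to be annihilated: the value at [z] of the combination of
     iterates of [u] is [ip u q]. *)
  set (q := lcomb (fun m => (lam ^ m) ^ (beta + 3)) (fun m => K (phi_iter m z)) N).
  assert (HK : forall m, A2 (K (phi_iter m z)))
    by (intros m; now apply inA2_kernel, phi_iter_in_disc).
  assert (Hq : A2 q) by (apply inA2_lcomb; auto).
  assert (HTq : forall l, A2 (Nat.iter l T q)) by (intros l; now apply comp_op_iter).
  assert (Z : lcomb (fun _ => 1) (fun l => Nat.iter l T q) N = (fun _ => RtoC 0)).
  { apply (eq_zero_of_eval beta); [apply inA2_lcomb; auto|]. intros w Hw.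
    rewrite inner_lcomb_l; auto; [|now apply inA2_kernel].
    rewrite <- (kernel_orbit_sum w z Hw Hz). apply csum_ext; intros l _.
    destruct (comp_op_iter l q Hq) as [_ HE]. rewrite HE, Cmult_1_l by assumption.
    unfold q. rewrite inner_lcomb_l; auto; [|now apply inA2_kernel, phi_iter_in_disc].
    apply csum_ext; intros m _. rewrite inner_kernel_kernel by now apply phi_iter_in_disc.
    reflexivity. }
  assert (I : forall l, ip (Nat.iter l T q) u = ip q u).
  { induction l as [|l IH]; [reflexivity|]. simpl. rewrite Hfix; auto. }
  (* All [N] iterates of [q] pair with [u] as [q] does, while their sum is zero by [Z]. *)
  assert (E : INR N * ip q u = 0).
  { rewrite <- csum_const, <- (inner_zero_l beta u), <- Z, inner_lcomb_l; auto.
    apply csum_ext; intros l _. rewrite I; ring. }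
  assert (Q : ip q u = 0).
  { replace (ip q u) with (INR N * ip q u / INR N); [rewrite E|]; field;
      intros F; apply RtoC_inj in F; apply not_0_INR in F; trivial; lia. }
  transitivity (ip u q).
  - unfold q. rewrite inner_lcomb_r; auto. apply csum_ext; intros m _.
    destruct (comp_op_iter m u Hu) as [_ HE]. rewrite HE; trivial.
  - rewrite inner_conj, Q. apply injective_projections; simpl; ring.
Qed.

(** Up to the factor [N], the sum is the value at 0 of the projection of [f] onto the
    [lam ^ (beta + 3)]-eigenspace. The conjugation moves this projection onto [Cj (K 0)], a vector
    fixed by the adjoint, where it vanishes. *)
Lemma complex_symmetric_orbit_functional (f : nat -> C) :
  complex_symmetric beta T -> A2 f ->
  csum (fun m => coef m * ip f (K (phi_iter m 0))) N = 0.
Proof.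
  intros (Cj & T' & HC & (HSA & HS) & HCS) Hf.
  assert (D0 : in_disc 0) by (unfold in_disc; rewrite Cmod_0; lra).
  assert (HK0 := inA2_kernel beta 0 D0).
  destruct (HC) as (HCA & _ & _ & HCip).
  assert (TA : forall m a, A2 a -> A2 (Nat.iter m T a))
    by (intros m a Ha; now apply comp_op_iter).
  assert (SA : forall m a, A2 a -> A2 (Nat.iter m T' a))
    by (intros m a Ha; induction m; simpl; auto).
  (* The kernel at 0 is the constant function 1, which composition preserves. *)
  assert (TK0 : T (K 0) = K 0).
  { apply (eq_of_eval beta); [apply (TA 1%nat); exact HK0|exact HK0|]. intros z Hz.
    destruct (comp_op_iter 1 (K 0) HK0) as [_ HE]. simpl in HE.
    rewrite HE, !inner_kernel_kernel by (trivial; now apply phi_iter_in_disc).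
    replace (Cconj 0) with (RtoC 0) by (apply injective_projections; simpl; ring).
    now rewrite !Cmult_0_r. }
  set (u := Cj (K 0)).
  assert (Hu : A2 u) by (now apply HCA).
  assert (Su : T' u = u) by (unfold u; rewrite <- HCS, TK0; trivial).
  assert (CT : forall m, Cj (Nat.iter m T f) = Nat.iter m T' (Cj f)).
  { induction m as [|m IH]; [reflexivity|]. simpl. rewrite HCS, IH; auto. }
  assert (Adj : forall m a, A2 a -> ip a (Nat.iter m T' (Cj f)) = ip (Nat.iter m T a) (Cj f)).
  { induction m as [|m IH]; intros a Ha; [reflexivity|].
    rewrite (Nat.iter_succ_r m _ T). simpl. rewrite <- HS by auto. apply IH, (TA 1%nat), Ha. }
  transitivity (ip (lcomb coef (fun m => Nat.iter m T f) N) (K 0)).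
  { rewrite inner_lcomb_l; auto. apply csum_ext; intros m _.
    destruct (comp_op_iter m f Hf) as [_ HE]. now rewrite HE. }
  (* The conjugation swaps the arguments: with P the sum of [coef m] times the iterates of T, the
     pairing of P f with [K 0] becomes that of [u] with Cj (P f), and then, by adjunction, of P u
     with [Cj f]. *)
  rewrite <- HCip by (trivial; apply inA2_lcomb; auto).
  rewrite (conjugation_lcomb beta Cj) by auto. fold u.
  transitivity (ip (lcomb coef (fun m => Nat.iter m T u) N) (Cj f)).
  - rewrite inner_lcomb_r, inner_lcomb_l; auto.
    apply csum_ext; intros m _. rewrite Cconj_conj, CT, Adj; auto.
  - rewrite projection_adjoint_fixed_eq0; trivial; [apply inner_zero_l|].
    intros a Ha. rewrite HS, Su; auto.
Qed.

Lemma not_complex_symmetric : ~ complex_symmetric beta T.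
Proof.
  intros HCS. assert (D0 : in_disc 0) by (unfold in_disc; rewrite Cmod_0; lra).
  (* The indices start at 1: the polynomial vanishes on the orbit of 0 except at [phi_iter 0 0], so
     only the term m = 0, with coefficient 1, survives. *)
  set (L := map (fun m => phi_iter m 0) (List.seq 1 (N - 1))).
  assert (E : csum (fun m => coef m * root_prod L (phi_iter m 0)) N = 0).
  { apply (csum_moments_root_prod coef (fun m => phi_iter m 0)). intros n.
    etransitivity; [|exact (complex_symmetric_orbit_functional _ HCS (inA2_single beta n 1))].
    apply csum_ext; intros m _. rewrite inner_single_kernel; trivial. now apply phi_iter_in_disc. }
  assert (Z : csum (fun m => coef (S m) * root_prod L (phi_iter (S m) 0)) (N - 1) = 0).
  { apply csum_zero; intros m Hm. rewrite root_prod_root; [ring|]. apply in_map_iff.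
    exists (S m). split; [reflexivity|]. apply in_seq; lia. }
  replace N with (S (N - 1)) in E by lia. rewrite csum_head in E. cbv beta in E, Z.
  rewrite Z in E. apply (root_prod_neq0 L (phi_iter 0 0)).
  - intros H. apply in_map_iff in H. destruct H as (m & Em & Hm). apply in_seq in Hm.
    apply (phi_iter_0_inj m); [lia|assumption].
  - etransitivity; [|exact E]. change (lam ^ 0) with (RtoC 1). rewrite Cpow_1_l.
    replace (Cconj 1) with (RtoC 1) by (apply injective_projections; simpl; ring). ring.
Qed.
End Operator.
End Elliptic.

Theorem theorem5p7 (beta : nat) (alpha lam : C) (N : nat)
  (halpha0 : alpha <> 0) (halpha : in_disc alpha)
  (hlam : Cmod lam = 1%R)
  (hN0 : (0 < N)%nat) (hN : lam ^ N = 1)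
  (hNmin : forall k : nat, (0 < k < N)%nat -> lam ^ k <> 1)
  (hNbig : (2 * (3 + beta) <= N)%nat)
  (T : (nat -> C) -> (nat -> C))
  (hT : is_comp_op beta (fun z => phi_alpha alpha (lam * phi_alpha alpha z)) T) :
  ~ complex_symmetric beta T.
Proof. eapply not_complex_symmetric; eassumption. Qed.
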